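(* Let $\mathbb{F}_q$ be a finite field with $q$ elements. Let $p > 0$, $n > 0$ and $k \geq 0$ be integers, and let $\lambda = (p+(k-1)n,\ p+(k-2)n,\ \ldots,\ p+n,\ p)$ be the $p$-shifted $n$-staircase of length $k$. (i) Assume that $k < n+1$ (with $p$ arbitrary). Then $$P(s_{\lambda} \mapsto 0) = 1 - \begin{cases} \prod\limits_{i=1}^{k-1} \left(1-\dfrac{1}{q^{i}}\right), & \text{if } p \leq k-1; \\ \prod\limits_{i=1}^{k} \left(1-\dfrac{1}{q^{i}}\right), & \text{if } p > k-1. \end{cases}$$ (ii) Assume that $p \leq n$ and $k \geq n+1$. Then $$P(s_{\lambda} \mapsto 0) = 1- \prod_{i=1}^{n} \left(1-\frac{1}{q^{i}}\right).$$
   Context: Let $\mathcal{P} = \mathbb{Z}[h_1, h_2, h_3, \ldots]$ be the polynomial ring in countably many indeterminates, and set $h_0 := 1$ and $h_m := 0$ for $m < 0$. For a partition $\lambda = (\lambda_1, \ldots, \lambda_k)$ of length $k$, the Schur function is $s_\lambda := \det\left( h_{\lambda_i - i + j} \right)_{1\leq i,j\leq k} \in \mathcal{P}$ (the determinant of the $0\times 0$-matrix is $1$). For $f \in \mathcal{P}$ and $a \in \mathbb{F}_q$, choose $N$ such that $f$ involves only $h_1, \ldots, h_N$; then $$P(f \mapsto a) := \frac{\#\{(z_1, \ldots, z_N) \in \mathbb{F}_q^N \mid f(z_1, \ldots, z_N) = a\}}{q^N},$$ where the integer coefficients of $f$ are mapped to $\mathbb{F}_q$. This does not depend on the choice of $N$.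 *)

(* Defs.v *)
From HB Require Import structures.
From mathcomp Require Import all_boot all_order all_algebra.
From mathcomp Require Import finmap.
From mathcomp.multinomials Require Import monalg.

Set Implicit Arguments.
Unset Strict Implicit.
Unset Printing Implicit Defensive.

Import Order.TTheory GRing.Theory Num.Theory.
Local Open Scope ring_scope.

(* The ring Z[h_1, h_2, h_3, ...]: formal Z-linear combinations of commutative
   monomials in indeterminates indexed by nat, where the index i stands for
   h_(i+1). *)
Definition hring : comNzRingType := {malg int[{cmonom nat}]}.

Definition h (m : int) : hring :=
  match m with
  | Posz 0 => 1
  | Posz i.+1 => << ucm i >>
  | Negz _ => 0
  end.

(* Rows and columns are numbered from 0, which does not change the
   difference j - i in the usual formula. *)
Definition schur (la : seq nat) : hring :=
  \det (\matrix_(i < size la, j < size la)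
          h ((nth 0%N la i)%:Z - i%:Z + j%:Z)).

Definition staircase (p n k : nat) : seq nat :=
  [seq (p + (k - i) * n)%N | i <- iota 1 k].

(* Least N such that f involves only h_1, ..., h_N. *)
Definition hvars (f : hring) : nat :=
  \max_(m <- msupp f) \max_(i <- finsupp m) i.+1.

Section Evaluation.
Variable F : finFieldType.

Definition cmeval (z : seq F) (m : {cmonom nat}) : F :=
  \prod_(i <- finsupp m) z`_i ^+ m i.

(* The sequence z is (z_1, ..., z_N), so z`_i is the value of h_(i+1); beyond
   the end of z the value is 0, which is irrelevant if hvars f <= size z. *)
Definition heval (z : seq F) (f : hring) : F := mmap intr (cmeval z) f.

Lemma cmeval_mmorphism z : mmorphism (cmeval z).
Proof.
have ext (A : {fset nat}) (m : {cmonom nat}) : fsubset (finsupp m) A ->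
    cmeval z m = \prod_(i <- A) z`_i ^+ m i.
  move=> sA; rewrite /cmeval (big_fset_incl _ sA) // => i _.
  by rewrite -cmE_neq0 negbK => /eqP ->; rewrite expr0.
split=> [m1 m2|]; last by rewrite /cmeval mdom1 big_seq_fset0.
rewrite (ext _ m1 (fsubsetUl _ (finsupp m2))).
rewrite (ext _ m2 (fsubsetUr (finsupp m1) _)) /cmeval mdomD -big_split /=.
by apply: eq_bigr => i _; rewrite cmM exprD.
Qed.

HB.instance Definition _ z :=
  isMultiplicative.Build {cmonom nat} F (cmeval z) (cmeval_mmorphism z).

HB.instance Definition _ z := GRing.isZmodMorphism.Build hring F (heval z)
  (@mmap_is_additive _ _ _ intr (cmeval z)).
HB.instance Definition _ z := GRing.isMonoidMorphism.Build hring F (heval z)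
  (rmorphism_monoidP (mmap intr (cmeval z))).

Lemma heval_h0 z : heval z (h 0) = 1.
Proof. exact: rmorph1. Qed.

Lemma heval_h z (i : nat) : heval z (h i.+1%:Z) = z`_i.
Proof.
by rewrite /heval /= mmapU /= rmorph1 mul1r /cmeval mdomU big_seq_fset1 cmUU.
Qed.

Definition probN (N : nat) (f : hring) (a : F) : rat :=
  #|[set z : N.-tuple F | heval z f == a]|%:R / #|F|%:R ^+ N.

Definition prob (f : hring) (a : F) : rat := probN (hvars f) f a.

Lemma heval_take N z f : (hvars f <= N)%N -> heval (take N z) f = heval z f.
Proof.
move=> leN; rewrite /heval !mmapE; apply: eq_big_seq => m mf.
congr (_ * _); apply: eq_big_seq => i im; rewrite nth_take //.
apply: leq_trans leN; rewrite /hvars (big_fsetD1 m) //= leq_max.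
by rewrite (big_fsetD1 i) //= leq_max leqnn.
Qed.

Lemma probN_succ N f a : (hvars f <= N)%N -> probN N.+1 f a = probN N f a.
Proof.
move=> leN; rewrite /probN.
have q0 : #|F|%:R != 0 :> rat by rewrite pnatr_eq0 -lt0n; apply/card_gt0P; exists 0.
suff -> : #|[set z : N.+1.-tuple F | heval z f == a]|
        = (#|[set z : N.-tuple F | heval z f == a]| * #|F|)%N.
  by rewrite natrM exprSr invfM mulrACA divff ?mulr1.
have inj : injective (fun u : N.-tuple F * F => [tuple of rcons u.1 u.2]).
  move=> [u x] [v y] /(congr1 val) /= /rcons_inj [/val_inj -> ->] //.
rewrite -[#|F|]cardsT -cardsX -(card_imset _ inj); apply/eq_card => z.
rewrite !inE; apply/idP/imsetP => [hz|[[u x]]].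
  have sz : size (take N z) == N by rewrite size_take size_tuple ltnSn.
  exists (Tuple sz, last 0 z); first by rewrite !inE /= heval_take ?hz ?andbT.
  apply: val_inj => /=; have := size_tuple z.
  case/lastP: (tval z) => // s x; rewrite size_rcons => -[<-].
  by rewrite last_rcons -cats1 take_size_cat ?cats1.
rewrite in_setX !inE andbT /= => hu ->; rewrite -(heval_take _ leN) /=.
by rewrite -cats1 take_size_cat ?size_tuple.
Qed.

Lemma prob_indep N f a : (hvars f <= N)%N -> prob f a = probN N f a.
Proof.
move/subnK <-; elim: (N - _)%N => // d IH.
by rewrite addSn probN_succ ?leq_addl.
Qed.

End Evaluation.

(* Main.v *)
Require Import Defs.
From HB Require Import structures.
From mathcomp Require Import all_boot all_order all_algebra.
From mathcomp Require Import mxabelem.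
From mathcomp Require Import zify ring.

(** Let m = n + 1 and read the rows of the defining matrix from bottom to top:
    entry j of row r is h_(p+1-k+rm+j).  Hence every row is the previous one
    shifted m places to the left (the nilpotent matrix S), with m fresh
    indeterminates entering on the right (the matrix E), and the row spaces of
    E and S are in direct sum.  Let A be the span of rows 0, ..., r-1, let x be
    row r, assumed to be outside A, and put kappa = rank A - rank (A S) and
    mu = rank E.
    Then (A + x) + E = E + A S, so that A + x meets E in dimension kappa + 1.
    If x S is not in A S, the next row is automatically independent of A + x
    and kappa does not change; if x S is in A S, the next row is dependent with
    probability q^(kappa+1-mu) and kappa increases by one (kappa + 1 = mu would
    make A + x stable under S, hence the whole space).  Either way the product
    of the factors 1 - q^(-i), 1 <= i <= mu - 1 - kappa, is preserved on
    average, so it is the probability that all the remaining rows are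
    independent, whatever the nonzero row 0 in the row space of E. *)

Set Implicit Arguments.
Unset Strict Implicit.
Unset Printing Implicit Defensive.

Import Order.TTheory GRing.Theory Num.Theory.
Local Open Scope ring_scope.

(** * Counting over a finite field *)

(** Modulo [R] the condition is an affine system in [e] with matrix [E *m cokermx R]. Its solutions,
    if any, form a translate of the kernel, and the rank of [E] modulo [R] is rank(R + E) - rank
    R. *)
Lemma card_affine_preim (F : finFieldType) (m k l : nat) (E : 'M[F]_(m, k))
    (y : 'rV[F]_k) (R : 'M[F]_(l, k)) :
  #|[set e : 'rV[F]_m | ((y + e *m E)%R <= R)%MS]| =
  if (y <= R + E)%MS then (#|F| ^ (m + \rank R - \rank (R + E)%MS))%N else 0%N.
Proof.
have preimE e : (e *m E <= R)%MS = (e <= kermx (E *m cokermx R))%MS.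
  by rewrite submxE -mulmxA; apply/eqP/sub_kermxP.
have rkK : \rank (kermx (E *m cokermx R)) = (m + \rank R - \rank (R + E)%MS)%N.
  rewrite mxrank_ker.
  have := mxrank_mul_ker (R + E)%MS (cokermx R).
  rewrite addsmxMr mulmx_coker adds0mx.
  have -> : \rank ((R + E) :&: kermx (cokermx R))%MS = \rank R.
    apply/eqmx_rank; apply/andP; split.
      rewrite submxE; have := capmxSr (R + E)%MS (kermx (cokermx R)).
      by move/sub_kermxP => ->.
    by rewrite sub_capmx addsmxSl; apply/sub_kermxP; rewrite mulmx_coker.
  by move=> <-; rewrite subnDr.
case: ifPn => [/sub_addsmxP[[a b] /= yE] | ynot]; last first.
  apply: eq_card0 => e; rewrite inE; apply: contraNF ynot => le_eR.
  rewrite -[y](addrK (e *m E)); apply: addmx_sub.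
    by apply: (submx_trans le_eR); apply: addsmxSl.
  by rewrite eqmx_opp (submx_trans (submxMl _ _)) ?addsmxSr.
have affE e :
  ((y + e *m E)%R <= R)%MS = ((e + b)%R <= kermx (E *m cokermx R))%MS.
  rewrite -preimE !submxE yE mulmxDl !mulmxDl -!mulmxA mulmx_coker !mulmx0 add0r.
  by rewrite addrC.
rewrite -rkK -card_rowg -(card_imset (rowg _) (addIr (- b))).
apply: eq_card => e; rewrite inE affE.
apply/idP/imsetP => [le_e|[u]]; first by exists (e + b); rewrite ?inE ?addrK.
by rewrite inE => le_u ->; rewrite subrK.
Qed.

Definition row_of_seq (F : finFieldType) (m : nat) (s : seq F) : 'rV[F]_m :=
  \row_(j < m) s`_j.

(** Conditioning on the first [a] coordinates, packed as a row vector; each application reveals the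
    indeterminates of one more row of the Schur matrix. *)
Lemma card_tuple_row_drop (F : finFieldType) (a b : nat)
    (Q : 'rV[F]_a -> seq F -> bool) :
  #|[set z : (a + b).-tuple F | Q (row_of_seq a z) (drop a z)]| =
  (\sum_(u : 'rV[F]_a) #|[set w : b.-tuple F | Q u w]|)%N.
Proof.
pose f (z : (a + b).-tuple F) := (row_of_seq a z, [tuple (z`_(a + i)) | i < b]).
have dropE (z : (a + b).-tuple F) : tval (f z).2 = drop a z.
  apply: (@eq_from_nth _ 0); rewrite ?size_drop size_tuple ?size_tuple ?addKn //.
  move=> i ltib; rewrite nth_drop.
  by rewrite -(tnth_nth 0 _ (Ordinal ltib)) tnth_mktuple.
have injf : injective f.
  move=> z1 z2 eqf; apply/val_inj/(@eq_from_nth _ 0); rewrite !size_tuple //.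
  move=> i lti; have [ltia|leai] := ltnP i a.
    have /rowP/(_ (Ordinal ltia)) := congr1 fst eqf.
    by rewrite !mxE.
  have := congr1 (fun t => (tval t.2)`_(i - a)) eqf.
  by rewrite !dropE !nth_drop subnKC.
under eq_bigr do rewrite -sum1dep_card.
rewrite pair_big_dep /= sum1dep_card -(card_imset _ injf).
apply: eq_card => [[u w]]; rewrite [RHS]inE /=.
apply/imsetP/idP => [[z] | Quw].
  by rewrite inE -dropE /= => Qz [-> ->].
have sz : size ([tuple u 0 i | i < a] ++ w) == (a + b)%N.
  by rewrite size_cat !size_tuple.
have fE : f (Tuple sz) = (u, w).
  congr (_, _); last first.
    by apply: val_inj; rewrite [LHS]dropE drop_size_cat ?size_tuple.
  apply/rowP=> j; rewrite mxE nth_cat size_tuple ltn_ord.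
  by rewrite -(tnth_nth 0) tnth_mktuple.
exists (Tuple sz) => //.
by rewrite inE -dropE -[row_of_seq _ _]/(f (Tuple sz)).1 fE.
Qed.

(** For a prime power [q], the proportion of invertible matrices among the j by j matrices over the
    field with [q] elements. *)
Definition qprod (q j : nat) : rat := \prod_(1 <= i < j.+1) (1 - 1 / q%:R ^+ i).

Lemma qprodS q j : qprod q j.+1 = qprod q j * (1 - 1 / q%:R ^+ j.+1).
Proof. by rewrite /qprod big_nat_recr. Qed.

(** * Spans of rows generated by shifting and adding fresh entries *)

Fixpoint shift_span (F : finFieldType) (m k : nat) (S : 'M[F]_k)
    (E : 'M[F]_(m, k)) (t : nat) (A : 'M[F]_k) (x : 'rV[F]_k) (s : seq F) :
    'M[F]_k :=
  if t is t'.+1 then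
    shift_span S E t' (A + <<x>>)%MS (x *m S + row_of_seq m s *m E) (drop m s)
  else (A + <<x>>)%MS.

Lemma rank_add_gen (F : finFieldType) (k : nat) (A : 'M[F]_k) (x : 'rV[F]_k) :
  \rank (A + <<x>>)%MS = (\rank A + ~~ (x <= A)%MS)%N.
Proof.
case: (boolP (x <= A)%MS) => [xA | xA].
  rewrite addn0; apply/eqmx_rank; rewrite addsmxSl addsmx_sub submx_refl.
  by rewrite genmxE xA.
apply/eqP; rewrite eqn_leq; apply/andP; split.
  apply: leq_trans (mxrank_adds_leqif _ _).1 _.
  by rewrite leq_add2l mxrank_gen rank_leq_row.
rewrite addn1; apply: rank_ltmx; rewrite ltmxE addsmxSl addsmx_sub submx_refl.
by rewrite genmxE.
Qed.

Lemma rank_shift_span (F : finFieldType) (m k : nat) (S : 'M[F]_k)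
    (E : 'M[F]_(m, k)) t A x s :
  (\rank (shift_span S E t A x s) <= \rank (A + <<x>>)%MS + t)%N.
Proof.
elim: t A x s => [|t IH] A x s /=; first by rewrite addn0.
apply: leq_trans (IH _ _ _) _; rewrite [X in (X + t)%N]rank_add_gen.
by rewrite addnS -addSn leq_add2r; case: (~~ _); rewrite ?addn1 ?addn0 //= leqnSn.
Qed.

(** Each of the [t] rows to come raises the rank by at most one, so a wasted row [x] cannot be made
    up for. *)
Lemma shift_span_not_full (F : finFieldType) (m k : nat) (S : 'M[F]_k)
    (E : 'M[F]_(m, k)) t A x s :
  (x <= A)%MS -> (\rank A + t < k)%N ->
  row_full (shift_span S E t A x s) = false.
Proof.
move=> xA ltk; rewrite -[row_full _]/(_ == _); apply/ltn_eqF.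
apply: leq_ltn_trans (rank_shift_span _ _ _ _ _ _) _.
by rewrite rank_add_gen xA addn0.
Qed.

(** The rank equation leaves no slack: [x] and all [t] later rows must be independent modulo [A].
    The last hypothesis is the invariant carried through the induction on [t]. *)
Lemma card_shift_span_full (F : finFieldType) (m k : nat) (S : 'M[F]_k)
    (E : 'M[F]_(m, k)) (d t : nat) (A : 'M[F]_k) (x : 'rV[F]_k) :
  (E :&: S)%MS = 0 ->
  (forall R : 'M[F]_k, (E <= R)%MS -> (R *m S <= R)%MS -> row_full R) ->
  (\rank A + t.+1)%N = k -> ~~ (x <= A)%MS ->
  (A + <<x>> + E :=: E + A *m S)%MS ->
  #|[set s : (t * m + d).-tuple F | row_full (shift_span S E t A x s)]|%:R =
  #|F|%:R ^+ (t * m + d) *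
    qprod #|F| (\rank E - (\rank A - \rank (A *m S)).+1).
Proof.
move=> ES0 gen; elim: t A x => [|t IH] A x rkA xA spanA; last first.
  pose R := (A + <<x>>)%MS; pose next (e : 'rV[F]_m) := x *m S + e *m E.
  have rkR : \rank R = (\rank A).+1 by rewrite rank_add_gen xA addn1.
  have disj (B : 'M[F]_k) : \rank (E + B *m S)%MS = (\rank E + \rank (B *m S))%N.
    apply: mxrank_disjoint_sum; apply/eqP; rewrite -submx0 -ES0.
    by rewrite sub_capmx capmxSl (submx_trans (capmxSr _ _)) ?submxMl.
  have rkRE : \rank (R + E)%MS = (\rank E + \rank (A *m S))%N.
    by rewrite (eqmx_rank (introT eqmxP spanA)) disj.
  have RS : (R *m S :=: A *m S + x *m S)%MS.
    apply: eqmx_trans (addsmxMr _ _ _) _.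
    by apply: adds_eqmx (eqmx_refl _) (eqmxMr _ (genmxE _)).
  have le_rk : (\rank R <= \rank (R + E)%MS)%N by rewrite mxrankS ?addsmxSl.
  have le_rkAS : (\rank (A *m S) <= \rank A)%N by rewrite mxrankM_maxl.
  pose kap := (\rank A - \rank (A *m S))%N.
  pose kapR := (\rank R - \rank (R *m S))%N.
  (* The induction hypothesis gives the same count [c] for every [e] that makes the next row
     independent, since [kapR] depends only on [R]. *)
  pose c : rat := #|F|%:R ^+ (t * m + d) * qprod #|F| (\rank E - kapR.+1).
  have nextE e : #|[set s : (t * m + d).-tuple F |
      row_full (shift_span S E t R (next e) s)]|%:R =
      (if ~~ (next e <= R)%MS then c else 0).
    case: ifPn => [not_eR | /negPn le_eR]; last first.
      apply/eqP; rewrite pnatr_eq0 cards_eq0; apply/eqP/setP => s.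
      by rewrite !inE shift_span_not_full // rkR; have := rkA; clear; lia.
    rewrite IH //; first by rewrite rkR addSnnS.
    have sAR : (A *m S <= R *m S)%MS by rewrite submxMr ?addsmxSl.
    have sxR : (x *m S <= R *m S)%MS by rewrite submxMr // -(genmxE x) addsmxSr.
    have sRE : (R <= E + R *m S)%MS.
      apply: submx_trans (addsmxSl R E) _.
      by rewrite spanA addsmxS.
    have seE B : (e *m E <= B + E)%MS.
      by rewrite (submx_trans (submxMl _ _)) ?addsmxSr.
    have sRNE : (R + E <= R + <<next e>> + E)%MS by rewrite addsmxS ?addsmxSl.
    have sNE : (next e <= R + <<next e>> + E)%MS.
      have := submx_trans (addsmxSr R <<next e>>%MS) (addsmxSl _ E).
      by rewrite genmxE.
    (* The invariant for the next step: [R] lies in E + A S by [spanA], and [next e] differs from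
       [x *m S] by an element of [E]. *)
    apply/eqmxP/andP; split.
      rewrite addsmx_sub addsmxSl andbT (addsmx_sub R) sRE genmxE /=.
      by rewrite addmx_sub ?(submx_trans sxR) ?addsmxSr // addsmxC.
    rewrite addsmx_sub addsmxSr RS addsmx_sub /=; apply/andP; split.
      by rewrite (submx_trans _ sRNE) // spanA addsmxSr.
    by rewrite -[x *m S](addrK (e *m E)) addmx_sub ?eqmx_opp.
  rewrite mulSn -addnA.
  rewrite (card_tuple_row_drop _
    (fun e s => row_full (shift_span S E t R (next e) s))).
  rewrite natr_sum (eq_bigr _ (fun e _ => nextE e)) -big_mkcond /= sumr_const.
  have card_good : (#|[pred e | ~~ (next e <= R)%MS]| +
     #|[set e : 'rV[F]_m | (next e <= R)%MS]|)%N = (#|F| ^ m)%N.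
    rewrite -[in RHS](mul1n m) -(card_mx F 1 m).
    rewrite -(cardsC [set e | (next e <= R)%MS]) addnC.
    by congr (_ + _)%N; apply: eq_card => e; rewrite !inE.
  move: card_good; rewrite card_affine_preim rkR rkRE.
  set g := #|_|; set rE := \rank E in rkRE *.
  set rS := \rank (A *m S) in rkRE le_rkAS kap *.
  have q_neq0 : #|F|%:R != 0 :> rat.
    by rewrite pnatr_eq0 -lt0n; apply/card_gt0P; exists 0.
  case: ifPn => [xS_RE | xS_nRE] card_good.
    have xS_A : (x *m S <= A *m S)%MS.
      move: xS_RE; rewrite spanA => /sub_addsmxP[[u v] /= xSE].
      suff u0 : u *m E = 0 by rewrite xSE u0 add0r submxMl.
      apply/eqP; rewrite -submx0 -ES0 sub_capmx submxMl /=.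
      have -> : u *m E = (x - v *m A) *m S by rewrite mulmxBl xSE mulmxA addrK.
      exact: submxMl.
    have rkRS : \rank (R *m S) = rS.
      by apply: eqmx_rank; rewrite !RS addsmxSl addsmx_sub submx_refl xS_A.
    (* Strictness ensures that the target product has one factor more than the one in [c]; this
       factor is the proportion of good [e]. *)
    have ltE : (kap.+1 < rE)%N.
      rewrite ltn_neqAle; apply/andP; split; last first.
        by move: le_rk; rewrite rkR rkRE /kap; move: le_rkAS; clear; lia.
      apply/eqP => kapE.
      have RE : (R + E <= R)%MS.
        rewrite -(geq_leqif (mxrank_leqif_sup (addsmxSl R E))) rkR rkRE -kapE.
        by rewrite /kap; move: le_rkAS; clear; lia.
      have : row_full R.
        apply: gen; first exact: submx_trans (addsmxSr _ _) RE.
        apply: submx_trans RE; rewrite RS spanA addsmx_sub addsmxSr.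
        by rewrite (submx_trans xS_A) ?addsmxSr.
      rewrite -[row_full _]/(_ == _) rkR => /eqP; have := rkA.
      by move: (\rank A) => a; clear; lia.
    have [j jE] : exists j, (rE - kap.+1)%N = j.+1.
      by exists (rE - kap.+2)%N; move: ltE; clear; lia.
    have -> : c = #|F|%:R ^+ (t * m + d) * qprod #|F| j.
      rewrite /c /kapR rkR rkRS; congr (_ * qprod _ _).
      by move: jE le_rkAS; rewrite /kap; clear; lia.
    rewrite jE qprodS.
    have rEm : (rE <= m)%N by exact: rank_leq_row.
    have gE : g%:R = #|F|%:R ^+ m * (1 - 1 / #|F|%:R ^+ j.+1) :> rat.
      have /(congr1 (fun i => i%:R : rat)) := card_good.
      rewrite natrD !natrX => /(canRL (addrK _)) ->.
      rewrite mulrBr mulr1 mul1r; congr (_ - _).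
      rewrite (_ : (_ - _)%N = (m - j.+1)%N); last first.
        move: jE rEm le_rkAS; rewrite /kap.
        by clear; lia.
      by rewrite expfB_cond // (negPf q_neq0) /=; move: jE rEm; clear; lia.
    by rewrite -[LHS]mulr_natr gE (exprD _ m); ring.
  (* Here no [e] makes the next row dependent, and the ranks of [R] and [R *m S] both grow by one,
     so [kapR] equals [kap]. *)
  have xS_nA : ~~ (x *m S <= A *m S)%MS.
    by apply: contra xS_nRE => xS_A; rewrite spanA (submx_trans xS_A) ?addsmxSr.
  have rkRS : \rank (R *m S) = rS.+1.
    rewrite (eqmx_rank (introT eqmxP RS)) -(adds_eqmx (eqmx_refl _) (genmxE _)).
    by rewrite rank_add_gen xS_nA addn1.
  rewrite /c /kapR rkR rkRS -[LHS]mulr_natr.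
  rewrite (_ : g = #|F| ^ m)%N; last by rewrite -card_good addn0.
  by rewrite natrX (exprD _ m) subSS; ring.
(* For [t = 0] the span is already full. The invariant then gives k = rank E + rank(A S), so that
   the product is empty. *)
have rkR : \rank (A + <<x>>)%MS = k by rewrite rank_add_gen xA addn1 -addn1.
have full : row_full (A + <<x>>)%MS by rewrite -[row_full _]/(_ == _) rkR.
rewrite (_ : [set s | _] = setT); last by apply/setP => s; rewrite !inE full.
rewrite cardsT card_tuple natrX.
have : \rank (A + <<x>> + E)%MS = k.
  apply/eqP; rewrite eqn_leq rank_leq_col -{1}rkR; apply: mxrankS.
  exact: addsmxSl.
rewrite (eqmx_rank (introT eqmxP spanA)).
rewrite mxrank_disjoint_sum; last first.
  apply/eqP; rewrite -submx0 -ES0.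
  by rewrite sub_capmx capmxSl (submx_trans (capmxSr _ _)) ?submxMl.
move=> rkE.
rewrite (_ : (_ - _)%N = 0%N) /qprod ?big_geq ?mulr1 //.
have := mxrankM_maxl A S; move: rkA rkE.
by move: (\rank E) (\rank A) (\rank (A *m S)) => rE rA rS; clear; lia.
Qed.

(** * The concrete shift and fresh-entry matrices *)

Definition shift_mx (F : finFieldType) (m k : nat) : 'M[F]_k :=
  \matrix_(i, j) (i == (j + m)%N :> nat)%:R.

(** The additive form of j = k - m + i stays correct for m > k, where the first m - k coordinates
    fall off on the left. *)
Definition fresh_mx (F : finFieldType) (m k : nat) : 'M[F]_(m, k) :=
  \matrix_(i, j) ((k + i)%N == (j + m)%N)%:R.

Lemma mul_shift_mx (F : finFieldType) (m k : nat) (v : 'rV[F]_k) (j : 'I_k) :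
  (v *m shift_mx F m k) 0 j = if insub (j + m)%N is Some i then v 0 i else 0.
Proof.
rewrite mxE; case: insubP => [i _ iE | nlt]; last first.
  apply: big1 => i _; rewrite mxE (_ : (_ == _) = false) ?mulr0 //.
  by apply: contraNF nlt => /eqP <-.
rewrite (bigD1 i) //= mxE iE eqxx mulr1 big1 ?addr0 // => l neq_li.
by rewrite mxE -iE val_eqE (negPf neq_li) mulr0.
Qed.

Lemma mul_fresh_mx (F : finFieldType) (m k : nat) (v : 'rV[F]_m) (j : 'I_k) :
  (v *m fresh_mx F m k) 0 j =
  if (k <= j + m)%N then
    (if insub (j + m - k)%N is Some i then v 0 i else 0)
  else 0.
Proof.
rewrite mxE; case: ifP => lek; last first.
  apply: big1 => i _; rewrite mxE (_ : (_ == _) = false) ?mulr0 //.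
  by apply/eqP; move: lek; lia.
case: insubP => [i _ iE | nlt]; last by move: nlt (ltn_ord j); lia.
rewrite (bigD1 i) //= mxE (_ : (_ == _) = true) ?mulr1; last first.
  by apply/eqP; rewrite iE; move: lek; lia.
rewrite big1 ?addr0 // => l neq_li.
rewrite mxE (_ : (_ == _) = false) ?mulr0 //.
apply: contraNF neq_li => /eqP eql; apply/eqP/val_inj; rewrite /= iE.
by move: eql; lia.
Qed.

(** Fresh entries occupy the last [m] columns, exactly where every shifted vector vanishes. *)
Lemma fresh_cap_shift (F : finFieldType) (m k : nat) :
  (fresh_mx F m k :&: shift_mx F m k)%MS = 0.
Proof.
apply/eqP/rowV0P => v; rewrite sub_capmx => /andP[/submxP[a va] /submxP[b vb]].
apply/rowP => j; rewrite [RHS]mxE; have [lek|ltk] := leqP k (j + m).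
  by rewrite vb mul_shift_mx insubF // ltnNge lek.
by rewrite va mul_fresh_mx leqNgt ltk.
Qed.

Lemma delta_sub_fresh (F : finFieldType) (m k : nat) (j : 'I_k) :
  (k <= j + m)%N -> ((delta_mx 0 j : 'rV[F]_k) <= fresh_mx F m k)%MS.
Proof.
move=> lek; have lt_m : (j + m - k < m)%N by move: (ltn_ord j); lia.
suff -> : delta_mx 0 j = row (Ordinal lt_m) (fresh_mx F m k) by apply: row_sub.
apply/rowP => l; rewrite !mxE eqxx /= eq_sym; congr (_%:R).
by congr nat_of_bool; rewrite -val_eqE; apply/eqP/eqP => /=; move: lek; lia.
Qed.

Lemma sub_fresh (F : finFieldType) (m k : nat) (v : 'rV[F]_k) :
  (forall j : 'I_k, (j + m < k)%N -> v 0 j = 0) -> (v <= fresh_mx F m k)%MS.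
Proof.
move=> v0; rewrite [v]row_sum_delta; apply: summx_sub => j _.
have [lek|/v0 ->] := leqP k (j + m); last by rewrite scale0r sub0mx.
by rewrite scalemx_sub ?delta_sub_fresh.
Qed.

(** The last [m] basis vectors lie in [R], and the shift sends basis vector j + m to basis vector j,
    so all the others follow from right to left. *)
Lemma fresh_generates (F : finFieldType) (m k : nat) (R : 'M[F]_k) :
  (0 < m)%N -> (fresh_mx F m k <= R)%MS -> (R *m shift_mx F m k <= R)%MS ->
  row_full R.
Proof.
move=> m0 ER RS; rewrite -sub1mx; apply/row_subP => j; rewrite row1.
have [l] := ubnP (k - j)%N; elim: l j => // l IH j lel.
have [lek|ltk] := leqP k (j + m).
  exact: submx_trans (delta_sub_fresh _ lek) ER.
suff -> : delta_mx 0 j = (delta_mx 0 (Ordinal ltk) : 'rV_k) *m shift_mx F m k.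
  by apply: submx_trans (submxMr _ (IH _ _)) RS => /=; move: ltk lel; lia.
by apply/rowP => i; rewrite -rowE !mxE eqxx /= eqn_add2r -val_eqE eq_sym.
Qed.

Lemma rank_fresh (F : finFieldType) (m k : nat) :
  \rank (fresh_mx F m k) = minn m k.
Proof.
have [lemk|/ltnW lekm] := leqP m k; last first.
  apply/eqP; rewrite -[_ == _]/(row_full _) -sub1mx; apply/row_subP => j.
  by rewrite row1 delta_sub_fresh // (leq_trans lekm) ?leq_addl.
apply/eqP/inj_row_free => v vE0; apply/rowP => i.
have ltk : (k + i - m < k)%N by move: (ltn_ord i) lemk; lia.
have := mul_fresh_mx v (Ordinal ltk); rewrite vE0 !mxE /= subnK; last first.
  by rewrite (leq_trans lemk) ?leq_addr.
rewrite leq_addr addKn; case: insubP => [l _ lE | ]; last by rewrite ltn_ord.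
by rewrite (val_inj lE).
Qed.

(** * The evaluated Schur matrix, read from the bottom row up *)

(* The value of h_(p+1-k+t); at t = 0 this is the bottom left corner of the
   matrix defining the Schur function. *)
Definition hseq (F : finFieldType) (p k : nat) (z : seq F) (t : nat) : F :=
  heval z (h (p%:Z + t%:Z + 1 - k%:Z)).

Lemma hseq_lt (F : finFieldType) (p k : nat) (z : seq F) (t : nat) :
  (p + t + 1 < k)%N -> hseq p k z t = 0.
Proof.
move=> ltk; rewrite /hseq (_ : _ - _ = Negz (k - (p + t + 1)).-1) ?raddf0 //.
by move: ltk; lia.
Qed.

Lemma hseq_eq (F : finFieldType) (p k : nat) (z : seq F) (t : nat) :
  (p + t + 1 = k)%N -> hseq p k z t = 1.
Proof.
move=> eqk; rewrite /hseq (_ : _ - _ = 0) ?heval_h0 //.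
by move: eqk; lia.
Qed.

Lemma hseq_gt (F : finFieldType) (p k : nat) (z : seq F) (t i : nat) :
  (p + t = k + i)%N -> hseq p k z t = z`_i.
Proof.
move=> eqk; rewrite /hseq (_ : _ - _ = i.+1%:Z) ?heval_h //.
by move: eqk; lia.
Qed.

Definition hrow (F : finFieldType) (p m k : nat) (z : seq F) (r : nat) : 'rV[F]_k :=
  \row_(j < k) hseq p k z (r * m + j).

(** Rows 0 to [r] involve only the first p + r m entries of [z], so the fresh entries start right
    after them. *)
Lemma hrowS (F : finFieldType) (p m k : nat) (z : seq F) (r : nat) :
  hrow p m k z r.+1 = hrow p m k z r *m shift_mx F m k +
    row_of_seq m (drop (p + r * m) z) *m fresh_mx F m k.
Proof.
apply/rowP => j; rewrite mxE [RHS]mxE mul_shift_mx mul_fresh_mx.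
have [lek|ltk] := leqP k (j + m).
  rewrite insubF ?add0r; last by rewrite ltnNge lek.
  case: insubP => [i _ iE|]; last by move: (ltn_ord j) lek; lia.
  rewrite mxE nth_drop; apply: hseq_gt; rewrite iE.
  by move: lek; rewrite mulSn; lia.
rewrite addr0; case: insubP => [i _ iE|]; last by rewrite ltk.
by rewrite mxE iE mulSn; congr hseq; lia.
Qed.

Lemma shift_span_hrow (F : finFieldType) (p m k : nat) (z : seq F) (t r : nat) :
  shift_span (shift_mx F m k) (fresh_mx F m k) t
    (\sum_(i < r) <<hrow p m k z i>>)%MS (hrow p m k z r) (drop (p + r * m) z) =
  (\sum_(i < r + t.+1) <<hrow p m k z i>>)%MS.
Proof.
elim: t r => [|t IH] r; first by rewrite addn1 big_ord_recr.
rewrite /= -hrowS drop_drop addnCA -mulSn.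
by have := IH r.+1; rewrite big_ord_recr /= addSnnS => <-.
Qed.

Lemma size_staircase p n k : size (staircase p n k) = k.
Proof. by rewrite size_map size_iota. Qed.

Lemma schur_neq0 (F : finFieldType) (p n k : nat) (z : seq F) :
  (heval z (schur (staircase p n k)) != 0) =
  row_full (\sum_(i < k) <<hrow p n.+1 k z i>>)%MS.
Proof.
pose M : 'M[hring]_k :=
  \matrix_(i < k, j < k) h ((nth 0%N (staircase p n k) i)%:Z - i%:Z + j%:Z).
have -> : schur (staircase p n k) = \det M.
  by rewrite /schur /M; move: (staircase p n k) (size_staircase p n k) => la <-.
rewrite -det_map_mx -unitfE -unitmxE -row_full_unit.
(* With j = k - 1 - i, the index p + jn - i + l equals p + 1 - k + j(n + 1) + l. *)
have rowM (i j : 'I_k) : (i + j = k.-1)%N ->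
    row i (map_mx (heval z) M) = hrow p n.+1 k z j.
  move=> ijk; apply/rowP => l; rewrite !mxE /hseq; congr (heval z (h _)).
  rewrite (nth_map 0%N) ?size_iota // nth_iota //.
  rewrite (_ : k - (1 + i) = j)%N; last by move: ijk (ltn_ord i); lia.
  by move: ijk (ltn_ord i) (ltn_ord j); rewrite mulnS; lia.
rewrite /row_full; congr (_ == _); apply: eqmx_rank; apply/andP; split.
  apply/row_subP => i; have lt_k : (k.-1 - i < k)%N by move: (ltn_ord i); lia.
  rewrite (rowM i (Ordinal lt_k)) /=; last by move: (ltn_ord i); lia.
  by apply: (sumsmx_sup (Ordinal lt_k)) => //; rewrite genmxE.
apply/sumsmx_subP => j _; have lt_k : (k.-1 - j < k)%N by move: (ltn_ord j); lia.
rewrite genmxE -(rowM (Ordinal lt_k) j) ?row_sub //=.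
by move: (ltn_ord j); lia.
Qed.

(** * From counts to probabilities, by cases on the first row *)

Lemma prob0_neq (F : finFieldType) (N : nat) (f : hring) :
  (hvars f <= N)%N ->
  prob f (0 : F) =
  1 - #|[set z : N.-tuple F | heval z f != 0]|%:R / #|F|%:R ^+ N.
Proof.
move=> leN; rewrite (prob_indep _ leN) /probN.
have qN0 : #|F|%:R ^+ N != 0 :> rat.
  by rewrite expf_neq0 // pnatr_eq0 -lt0n; apply/card_gt0P; exists 0.
rewrite -[X in X - _](divff qN0) -mulrBl; congr (_ / _).
have := cardsC [set z : N.-tuple F | heval z f == 0].
rewrite card_tuple -natrX => <-.
rewrite natrD (_ : ~: _ = [set z : N.-tuple F | heval z f != 0]) ?addrK //.
by apply/setP => z; rewrite !inE.
Qed.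

(** Row 0 is the same for every shift width, here set to 0, and is determined by the first [p]
    entries of [z]. *)
Definition hrow0 (F : finFieldType) (p k : nat) (u : 'rV[F]_p) : 'rV[F]_k :=
  hrow p 0 k [seq u 0 i | i <- enum 'I_p] 0.

Lemma hrow0E (F : finFieldType) (p m k : nat) (z : seq F) :
  hrow p m k z 0 = hrow0 k (row_of_seq p z).
Proof.
apply/rowP => j; rewrite !mxE !mul0n !add0n.
have [ltk|] := ltnP (p + j + 1) k; first by rewrite !hseq_lt.
rewrite leq_eqVlt => /orP[/eqP/esym eqk|gtk]; first by rewrite !hseq_eq.
have lt_p : (p + j - k < p)%N by move: gtk (ltn_ord j); lia.
rewrite !(@hseq_gt _ _ _ _ _ (p + j - k)) ?subnKC //; try by move: gtk; lia.
by rewrite (nth_map (Ordinal lt_p)) ?size_enum_ord // mxE nth_enum_ord.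
Qed.

Lemma card_schur_neq0 (F : finFieldType) (p n k d : nat) :
  #|[set z : (p + (k * n.+1 + d)).-tuple F |
     heval z (schur (staircase p n k.+1)) != 0]| =
  (\sum_(u : 'rV[F]_p) #|[set w : (k * n.+1 + d).-tuple F |
     row_full (shift_span (shift_mx F n.+1 k.+1) (fresh_mx F n.+1 k.+1) k
                 0 (hrow0 k.+1 u) w)]|)%N.
Proof.
rewrite -(card_tuple_row_drop _
  (fun u w => row_full (shift_span _ _ k 0 (hrow0 k.+1 u) w))).
apply: eq_card => z; rewrite !inE schur_neq0.
have := shift_span_hrow p n.+1 k.+1 z k 0.
by rewrite big_ord0 mul0n addn0 add0n hrow0E => ->.
Qed.

(** For [A = 0] the invariant just says that [x] lies in the row space of the fresh entries; in the
    overview's terms, kappa is 0 and mu is the minimum of [m] and [k.+1]. *)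
Lemma card_first_row (F : finFieldType) (m k d : nat) (x : 'rV[F]_k.+1) :
  (0 < m)%N -> (x <= fresh_mx F m k.+1)%MS ->
  #|[set w : (k * m + d).-tuple F | row_full
      (shift_span (shift_mx F m k.+1) (fresh_mx F m k.+1) k 0 x w)]|%:R =
  if x != 0 then #|F|%:R ^+ (k * m + d) * qprod #|F| (minn m k.+1).-1 else 0.
Proof.
move=> m0 xE; case: ifPn => [x0 | /negPn/eqP ->]; last first.
  apply/eqP; rewrite pnatr_eq0 cards_eq0; apply/eqP/setP => w.
  by rewrite !inE shift_span_not_full ?sub0mx // mxrank0.
rewrite card_shift_span_full ?mxrank0 ?submx0 //.
- by rewrite mul0mx mxrank0 rank_fresh subn1.
- exact: fresh_cap_shift.
- by move=> R; apply: fresh_generates.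
apply/eqmxP; rewrite mul0mx !addsmx_sub !sub0mx genmxE addsmxSl addsmxSr.
by rewrite (submx_trans xE) ?addsmxSl.
Qed.

Theorem theorem3p2 (F : finFieldType) (q p n k : nat) :
  #|F| = q -> (0 < p)%N -> (0 < n)%N ->
  ((k < n + 1)%N ->
     prob (schur (staircase p n k)) (0 : F) =
     1 - (if (p%:Z <= k%:Z - 1) then
            \prod_(1 <= i < k) (1 - 1 / q%:R ^+ i)
          else \prod_(1 <= i < k.+1) (1 - 1 / q%:R ^+ i)))
  /\
  ((p <= n)%N -> (n + 1 <= k)%N ->
     prob (schur (staircase p n k)) (0 : F) =
     1 - \prod_(1 <= i < n.+1) (1 - 1 / q%:R ^+ i)).
Proof.
move=> <- _ _; set f := schur (staircase p n k).
have q0 N : #|F|%:R ^+ N != 0 :> rat.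
  by rewrite expf_neq0 // pnatr_eq0 -lt0n; apply/card_gt0P; exists 0.
case: k @f => [|k] f.
  split=> [_|_]; last by rewrite addn1.
  have f1 : f = 1 by rewrite /f /schur det_mx00.
  rewrite (prob0_neq F (leqnn _)) (_ : (_ <= _) = false) ?big_geq //.
  rewrite (_ : [set z | _] = setT) ?cardsT ?card_tuple ?natrX ?divff //.
  by apply/setP => z; rewrite !inE [X in heval z X]f1 rmorph1 oner_eq0.
have cancel (a b c : rat) : a != 0 -> b != 0 -> b * c * a / (a * b) = c.
  by move=> a0 b0; field; rewrite a0 b0.
(* The hvars f unused coordinates spare us from computing hvars f. *)
have leN : (hvars f <= p + (k * n.+1 + hvars f))%N by rewrite addnA leq_addl.
(* The length is now [k.+1]. Row 0 contains h_0 = 1 in column k - p, so it never vanishes, and p <=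
   n confines it to the last n + 1 columns. *)
have small : (p <= minn n k)%N -> prob f (0 : F) = 1 - qprod #|F| (minn n k).
  rewrite leq_min => /andP[lepn lepk].
  rewrite (prob0_neq F leN) card_schur_neq0 natr_sum.
  rewrite (eq_bigr (fun=> #|F|%:R ^+ (k * n.+1 + hvars f) * qprod #|F| (minn n k))).
    rewrite sumr_const card_mx mul1n -[X in X / _]mulr_natr natrX (exprD _ p).
    by congr (_ - _); apply: cancel; apply: q0.
  move=> u _; rewrite card_first_row //; last first.
    apply: sub_fresh => j ltk; rewrite mxE hseq_lt //.
    by move: ltk lepn; lia.
  rewrite minnSS ifT //; apply/eqP.
  move=> /rowP/(_ (Ordinal (leq_subr p k : (k - p < k.+1)%N))).
  rewrite !mxE hseq_eq => [/eqP|]; first by rewrite oner_eq0.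
  by rewrite /=; move: lepk; lia.
(* Now row 0 consists of k + 1 distinct indeterminates. It is nonzero with probability 1 -
   q^(-(k+1)), the last factor of the product. *)
have large : (k < p)%N -> (k < n)%N -> prob f (0 : F) = 1 - qprod #|F| k.+1.
  move=> ltkp ltkn.
  have xE (u : 'rV[F]_p) : hrow0 k.+1 u = u *m fresh_mx F p k.+1.
    apply/rowP => j; rewrite mxE mul_fresh_mx mul0n add0n.
    have lekj : (k.+1 <= j + p)%N by move: ltkp; lia.
    rewrite lekj; case: insubP => [i _ iE|]; last by move: (ltn_ord j) lekj; lia.
    rewrite (@hseq_gt _ _ _ _ _ i); last by rewrite iE; move: lekj; lia.
    by rewrite (nth_map i) ?size_enum_ord // nth_ord_enum.
  rewrite (prob0_neq F leN) card_schur_neq0 natr_sum.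
  pose c : rat := #|F|%:R ^+ (k * n.+1 + hvars f) * qprod #|F| k.
  rewrite (eq_bigr (fun u => if hrow0 k.+1 u != 0 then c else 0)); last first.
    move=> u _; rewrite card_first_row //; last first.
      by apply: sub_fresh => j; move: ltkn; lia.
    by rewrite minnSS (minn_idPr (ltnW ltkn)).
  rewrite -big_mkcond sumr_const -[X in X / _]mulr_natr.
  have -> : #|[pred u : 'rV[F]_p | hrow0 k.+1 u != 0]|%:R =
      #|F|%:R ^+ p * (1 - 1 / #|F|%:R ^+ k.+1) :> rat.
    have := cardsC [set u : 'rV[F]_p |
      ((0 + u *m fresh_mx F p k.+1)%R <= (0 : 'M_k.+1))%MS].
    rewrite card_affine_preim sub0mx adds0mx mxrank0 addn0 rank_fresh.
    rewrite (minn_idPr ltkp) card_mx mul1n => /(congr1 (fun i => i%:R : rat)).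
    rewrite natrD !natrX => /(canRL (addKr _)) cE.
    rewrite (_ : #|_| = #|~: [set u : 'rV[F]_p |
      ((0 + u *m fresh_mx F p k.+1)%R <= (0 : 'M_k.+1))%MS]|); last first.
      by apply: eq_card => u; rewrite !inE add0r submx0 xE.
    rewrite cE addrC mulrBr mulr1 mul1r expfB_cond //.
    by rewrite -[X in X == 0]expr1 (negPf (q0 1%N)).
  rewrite qprodS (exprD _ p) [X in X / _]mulrCA [X in X / _]mulrC.
  by rewrite -[X in X * _ / _]mulrA cancel ?q0.
split=> [ltk|lepn lek].
  have ltkn : (k < n)%N by rewrite addn1 in ltk.
  case: ifP => lepk.
    rewrite small; first by rewrite (minn_idPr (ltnW ltkn)).
    by rewrite (minn_idPr (ltnW ltkn)); move: lepk; lia.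
  by rewrite large //; move: lepk; lia.
by rewrite small (minn_idPl _) //; move: lek; rewrite addn1.
Qed.
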